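(* Let $q\in\mathbb{N}$, $\lambda>0$, $0<\theta<1$ and $a_1,\dots,a_q>0$, and let $\{\bar G(t)\}_{t\ge0}$ be the multivariate gamma subordinator with these parameters (defined in the context). Then for every $t>0$ the random vector $\bar G(t)$ has the probability density function $$g(\bar{x},t)= \frac{(1-\theta)^{\lambda t}}{\Gamma(\lambda t)}\sum_{n=0}^{\infty}\frac{\theta^n}{n!\,(\Gamma(n+\lambda t))^{q-1}}\prod_{i=1}^{q}\frac{(a_ix_i)^{n+\lambda t}}{x_i}e^{-a_ix_i},\qquad \bar{x}=(x_1,\dots,x_q)\in(0,\infty)^q .$$
   Context: For $i=1,\dots,q$, $\{Z_i(t)\}_{t\ge0}$ is a gamma Lévy process: $Z_i(0)=0$ and for $t>0$ the variable $Z_i(t)$ has the gamma distribution with shape $\lambda t$ and rate $a_i$, i.e. density $\frac{a_i^{\lambda t}}{\Gamma(\lambda t)}x^{\lambda t-1}e^{-a_ix}$, $x>0$. $\{B^-(\lambda t)\}_{t\ge0}$ is a negative binomial Lévy process with parameter $\theta$: $\Pr\{B^-(\lambda t)=n\}=(1-\theta)^{\lambda t}\binom{n+\lambda t-1}{n}\theta^n$, $n\in\{0,1,2,\dots\}$. The processes $Z_1,\dots,Z_q,B^-$ are mutually independent. The multivariate gamma subordinator is $\bar G(t)=(G_1(t),\dots,G_q(t))$ with $G_i(t)=Z_i\big(t+\lambda^{-1}B^-(\lambda t)\big)$, $t\ge0$; its components are conditionally independent given $\{B^-(\lambda t)\}_{t\ge0}$. *)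

(* Defs.v *)
From HB Require Import structures.
From mathcomp Require Import all_boot all_order all_algebra.
From mathcomp Require Import all_classical all_reals all_analysis.

Set Implicit Arguments.
Unset Strict Implicit.
Unset Printing Implicit Defensive.

Import Order.TTheory GRing.Theory Num.Theory.
Import numFieldNormedType.Exports.

Local Open Scope classical_set_scope.
Local Open Scope ring_scope.

Section lebesgue_tuple_step.
Context {R : realType}.

Definition tcons n (p : measurableTypeR R * n.-tuple R) : n.+1.-tuple R :=
  [tuple of p.1 :: p.2].

Lemma measurable_tcons n : measurable_fun setT (@tcons n).
Proof. exact: measurable_cons. Qed.

Variables (n : nat) (m : {sigma_finite_measure set (n.-tuple R) -> \bar R}).

Definition lebesgue_tcons : set (n.+1.-tuple R) -> \bar R :=
  pushforward (lebesgue_measure \x m)%E (@tcons n).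

Let mu := measure_function_pushforward__canonical__measure_function_Measure
  (lebesgue_measure \x m)%E (@measurable_tcons n).

HB.instance Definition _ := isMeasure.Build _ _ _ lebesgue_tcons
  (@measure0 _ _ _ mu) (@measure_ge0 _ _ _ mu)
  (@measure_semi_sigma_additive _ _ _ mu).

Lemma measurable_tuple_box (A : 'I_n -> set R) :
  (forall i, measurable (A i)) ->
  measurable [set x : n.-tuple R | forall i, A i (tnth x i)].
Proof.
move=> mA; rewrite (_ : mkset _ =
    \bigcap_(i in [set: 'I_n]) ((@tnth n R)^~ i @^-1` A i)); last first.
  by apply/seteqP; split=> x xA i; [move=> _|]; apply: xA.
apply: fin_bigcap_measurable => // i _.
by rewrite -[X in measurable X]setTI; exact: measurable_tnth.
Qed.

Lemma lebesgue_tcons_sigma_finite : sigma_finite setT lebesgue_tcons.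
Proof.
have /sigma_finiteP [F [FT Fnd Foo]] := sigma_finiteT (@lebesgue_measure R).
have /sigma_finiteP [G [GT Gnd Goo]] := sigma_finiteT m.
exists (fun k => [set x : n.+1.-tuple R |
    F k (thead x) /\ G k [tuple of behead x]]).
  apply/seteqP; split => // x _.
  have [i _ Fi] : (\bigcup_i F i) (thead x) by rewrite -FT.
  have [j _ Gj] : (\bigcup_i G i) [tuple of behead x] by rewrite -GT.
  exists (maxn i j) => //; split.
    by have /subsetPset := Fnd _ _ (leq_maxl i j); apply.
  by have /subsetPset := Gnd _ _ (leq_maxr i j); apply.
move=> k; have [mF Fk] := Foo k; have [mG Gk] := Goo k; split.
  apply: measurableI.
    rewrite -[X in measurable X]setTI.
    exact: (@measurable_tnth _ R n.+1 ord0 measurableT _ mF).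
  rewrite -[X in measurable X]setTI.
  exact: (@measurable_behead _ R n measurableT _ mG).
rewrite /lebesgue_tcons /pushforward (_ : _ @^-1` _ = F k `*` G k).
  by rewrite product_measure1E// lte_mul_pinfty// ge0_fin_numE.
have bE (x : R) (y : n.-tuple R) : [tuple of behead (x :: y)] = y.
  exact: val_inj.
by apply/seteqP; split => -[x y] /=; rewrite theadE bE.
Qed.

HB.instance Definition _ :=
  @Measure_isSigmaFinite.Build _ _ _ lebesgue_tcons lebesgue_tcons_sigma_finite.

End lebesgue_tuple_step.

(* The Lebesgue measure on R^n, seen as n.-tuple R: the n-fold product of the
   one-dimensional one; lebesgue_tuple_box gives its value on rectangles. *)
Fixpoint lebesgue_tuple (R : realType) (n : nat) :
    {sigma_finite_measure set (n.-tuple R) -> \bar R} :=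
  match n return {sigma_finite_measure set (n.-tuple R) -> \bar R} with
  | 0 => \d_([tuple] : 0.-tuple R)
  | k.+1 => lebesgue_tcons (lebesgue_tuple R k)
  end.

Lemma lebesgue_tuple_box (R : realType) (n : nat) (A : 'I_n -> set R) :
  (forall i, measurable (A i)) ->
  lebesgue_tuple R n [set x : n.-tuple R | forall i, A i (tnth x i)] =
  (\prod_(i < n) lebesgue_measure (A i))%E.
Proof.
elim: n A => [|n IH] A mA.
  rewrite big_ord0 /= diracE mem_set//= => -[].
  by [].
rewrite big_ord_recl -IH; last by move=> i; exact: mA.
pose B := [set y : n.-tuple R | forall i, A (lift ord0 i) (tnth y i)].
have mB : measurable B := measurable_tuple_box (fun i => mA (lift ord0 i)).
transitivity ((lebesgue_measure \x lebesgue_tuple R n)%E (A ord0 `*` B)).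
  rewrite /= /lebesgue_tcons /pushforward.
  congr (_ _); apply/seteqP; split => -[x y] /=.
    move=> xyA; split; first exact: (xyA ord0).
    by move=> i; have := xyA (lift ord0 i); rewrite tnthS.
  move=> [Ax Ay] i; case: (unliftP ord0 i) => [j|] ->; last exact: Ax.
  by rewrite tnthS; exact: Ay.
have := @product_measure1E _ _ _ _ R lebesgue_measure (lebesgue_tuple R n)
  (A ord0) B.
by apply => //; exact: mA.
Qed.

Section special_functions.
Context {R : realType}.

Definition Gamma (s : R) : R :=
  \int[lebesgue_measure]_(x in `]0, +oo[) (x `^ (s - 1) * expR (- x)).

(* 'C(x, n) for a real upper argument: x (x - 1) ... (x - n + 1) / n! *)
Definition gbinom (x : R) (n : nat) : R :=
  (\prod_(i < n) (x - i%:R)) / n`!%:R.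

Definition gamma_pdf (shape rate x : R) : R :=
  if 0 < x then
    rate `^ shape / Gamma shape * x `^ (shape - 1) * expR (- (rate * x))
  else 0.

End special_functions.

Section processes.
Context d (T : measurableType d) (R : realType) (P : probability T R).

Definition mutually_independent (I : finType) (F : I -> set (set T)) : Prop :=
  forall (J : {set I}) (E : I -> set T),
    (forall i, i \in J -> F i (E i)) ->
    P (\bigcap_(i in [set` J]) E i) = (\prod_(i in J) P (E i))%E.

Definition sigma_rv d' (S : measurableType d') (X : T -> S) : set (set T) :=
  preimage_set_system setT X measurable.

(* A process is a function of the time t : R and of the outcome; only the times
   t >= 0 matter. *)
Definition sigma_process d' (S : measurableType d') (X : R -> T -> S) :
    set (set T) :=
  <<s \bigcup_(t in [set t : R | 0 <= t]) sigma_rv (X t) >>.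

(* Real-valued Levy process. Path regularity is not required: a cadlag
   modification always exists. *)
Record levy_process (X : R -> T -> R) : Prop := LevyProcess {
  levy_measurable : forall t, 0 <= t -> measurable_fun setT (X t) ;
  levy_start : {ae P, forall w, X 0 w = 0} ;
  levy_independent_increments : forall (n : nat) (t : nat -> R),
    0 <= t 0%N -> (forall k, t k <= t k.+1) ->
    mutually_independent
      (fun k : 'I_n => sigma_rv (fun w => X (t k.+1) w - X (t k) w)) ;
  levy_stationary_increments : forall (s t : R) (A : set R),
    0 <= s -> 0 <= t -> measurable A ->
    P [set w | A (X (s + t) w - X s w)] = P [set w | A (X t w - X 0 w)] ;
  levy_stochastic_continuity : forall t e : R, 0 <= t -> 0 < e ->
    P [set w | e < `|X s w - X t w|] @[s --> within [set s | 0 <= s] (nbhs t)]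
      --> 0%E }.

Definition gamma_levy_process (lambda rate : R) (X : R -> T -> R) : Prop :=
  levy_process X /\
  forall (t : R) (A : set R), 0 < t -> measurable A ->
    P (X t @^-1` A) =
    (\int[lebesgue_measure]_(x in A) (gamma_pdf (lambda * t) rate x)%:E)%E.

Definition negative_binomial_levy_process (lambda theta : R)
    (X : R -> T -> nat) : Prop :=
  levy_process (fun t w => (X t w)%:R) /\
  forall (t : R) (n : nat), 0 <= t ->
    P (X t @^-1` [set n]) =
    ((1 - theta) `^ (lambda * t) * gbinom (n%:R + lambda * t - 1) n
      * theta ^+ n)%:E.

Definition has_density (q : nat) (X : T -> q.-tuple R) (g : q.-tuple R -> R) :
    Prop :=
  [/\ measurable_fun setT X, measurable_fun setT g, forall x, 0 <= g x &
    forall A : set (q.-tuple R), measurable A ->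
      P (X @^-1` A) = (\int[lebesgue_tuple R q]_(x in A) (g x)%:E)%E].

End processes.

Section multivariate_gamma.
Context {R : realType}.

Definition gamma_subordinator (T : Type) (q : nat) (lambda : R)
    (Z : 'I_q -> R -> T -> R) (B : R -> T -> nat) (t : R) (w : T) : q.-tuple R :=
  [tuple Z i (t + lambda^-1 * (B (lambda * t) w)%:R) w | i < q].

Definition gamma_subordinator_term (q : nat) (lambda theta : R)
    (a : 'I_q -> R) (t : R) (x : q.-tuple R) (n : nat) : R :=
  theta ^+ n / (n`!%:R * Gamma (n%:R + lambda * t) ^+ q.-1)
  * \prod_(i < q) ((a i * tnth x i) `^ (n%:R + lambda * t) / tnth x i
                   * expR (- (a i * tnth x i))).

Definition gamma_subordinator_pdf (q : nat) (lambda theta : R)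
    (a : 'I_q -> R) (t : R) (x : q.-tuple R) : R :=
  if [forall i, 0 < tnth x i] then
    (1 - theta) `^ (lambda * t) / Gamma (lambda * t)
    * limn (series (gamma_subordinator_term lambda theta a t x))
  else 0.

End multivariate_gamma.

(* Main.v *)
(* Conditionally on B^-(lambda t) = n, independence makes the components of
   G(t) independent gamma variables of shape n + lambda t, so on a box
   P(G(t) in A) is the mixture, with negative binomial weights, of products of
   gamma integrals. The identity Gamma(n + s) = Gamma(s) s (s+1) ... (s+n-1)
   cancels one of the q factors Gamma(n + s) against the binomial weight, which
   turns the n-th summand into the n-th term of the series, and Tonelli swaps
   sum and integral. Boxes form a pi-system generating the measurable sets. *)

Require Import Defs.
From HB Require Import structures.
From mathcomp Require Import all_boot all_order all_algebra.
From mathcomp Require Import all_classical all_reals all_analysis.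
From mathcomp Require Import measurable_realfun ring.

Set Implicit Arguments.
Unset Strict Implicit.
Unset Printing Implicit Defensive.

Import Order.TTheory GRing.Theory Num.Theory.
Import numFieldNormedType.Exports.

Local Open Scope classical_set_scope.
Local Open Scope ring_scope.

(** * The Gamma function: functional equation and rising factorials *)

Section gamma_function.
Context {R : realType}.
Implicit Types (s a b : R) (n : nat).
Local Notation mu := (@lebesgue_measure R).

(** The exponential series gives x^(k+1)/(k+1)! <= e^x for x >= 0. Taking k >= s, the function is at
    most (k+1)!/x once x >= 1. *)
Lemma powR_expRN_cvgy s : x `^ s * expR (- x) @[x --> +oo] --> (0 : R).
Proof.
pose k := (Num.truncn s).+1.
apply: (@squeeze_cvgr _ _ _ _ (cst 0) (fun x : R => k.+1`!%:R * x^-1)).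
- near=> x; rewrite mulr_ge0 ?powR_ge0 ?expR_ge0//=.
  have x1 : 1 <= x by near: x; apply: nbhs_pinfty_ge; rewrite num_real.
  have x0 : 0 < x by exact: lt_le_trans x1.
  rewrite expRN ler_pdivrMr ?expR_gt0// mulrAC ler_pdivlMr//.
  have sk : s <= k%:R by rewrite ltW// truncnS_gt.
  apply: (@le_trans _ _ (x ^+ k.+1)).
    rewrite exprSr ler_wpM2r// ?(ltW x0)//.
    by rewrite -powR_mulrn ?(ltW x0)//; apply: ler_powR.
  have := expR_ge1Dxn k (ltW x0).
  rewrite -ler_pdivrMl ?ltr0n ?fact_gt0// mulrC; apply: le_trans.
  by rewrite lerDr.
- exact: cvg_cst.
- rewrite -[X in _ --> X](mulr0 k.+1`!%:R); apply: cvgMl_tmp.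
  by apply/gtr0_cvgV0; [exact: nbhs_pinfty_gt|exact: cvg_id].
Unshelve. all: by end_near. Qed.

Lemma continuous_powR_gt0 s (x : R) : 0 < x ->
  {for x, continuous (@powR R ^~ s)}.
Proof.
move=> x0; apply: differentiable_continuous; apply/derivable1_diffP.
by have [] := is_derive1_powR s x0.
Qed.

(** Staying on a compact interval away from 0 keeps x^s differentiable and x^(s-1) continuous,
    whatever the exponent. *)
Lemma integral_gamma_parts s a b : 0 < a -> a < b ->
  (\int[mu]_(x in `[a, b]) (x `^ s * expR (- x))%:E =
   (a `^ s * expR (- a) - b `^ s * expR (- b))%:E +
   s%:E * \int[mu]_(x in `[a, b]) (x `^ (s - 1) * expR (- x))%:E)%E.
Proof.
move=> a0 ab.
have b0 := lt_trans a0 ab.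
have pos (x : R) : x \in `]a, b[ -> 0 < x.
  by rewrite in_itv/= => /andP[+ _]; exact: lt_trans.
have dexpN (x : R) : is_derive x 1 (fun y : R => - expR (- y)) (expR (- x)).
  by apply: is_derive_eq; rewrite mulrN1 opprK.
have cexpN : continuous (fun x : R => expR (- x)).
  move=> x; apply: (@continuous_comp _ _ _ (fun y : R => - y) expR).
    exact: opp_continuous.
  exact: continuous_expR.
rewrite (@integration_by_parts R (@powR R ^~ s) (fun x => - expR (- x))
  (fun x => s * x `^ (s - 1)) (fun x => expR (- x)) a b) //.
- congr (_%:E + _)%E; first by rewrite !mulrN opprK addrC.
  under eq_integral => x _.
    rewrite (_ : _ * _ = - s * (x `^ (s - 1) * expR (- x))); last first.
      by rewrite mulrN -mulrA mulNr.
    rewrite EFinM; over.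
  rewrite integralZl//= ?EFinN ?mulNe ?oppeK//.
  apply: continuous_compact_integrable; first exact: segment_compact.
  apply: continuous_in_subspaceT => x; rewrite inE/= in_itv/= => /andP[ax _].
  apply: cvgM; last exact: cexpN.
  by apply: continuous_powR_gt0; exact: lt_le_trans a0 ax.
- apply: continuous_in_subspaceT => x; rewrite inE/= in_itv/= => /andP[ax _].
  apply: cvgM; first exact: cvg_cst.
  by apply: continuous_powR_gt0; exact: lt_le_trans a0 ax.
- split.
  + by move=> x /pos x0; have [] := is_derive1_powR s x0.
  + by apply: cvg_at_right_filter; exact: continuous_powR_gt0.
  + by apply: cvg_at_left_filter; exact: continuous_powR_gt0.
- by move=> x /pos x0; rewrite powR_derive1// in_itv/= andbT.
- exact: continuous_subspaceT.
- split.
  + by move=> x _; have [] := dexpN x.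
  + by apply: cvg_at_right_filter; apply: cvgN; exact: cexpN.
  + by apply: cvg_at_left_filter; apply: cvgN; exact: cexpN.
- by move=> x _; rewrite derive1E; apply: derive_val.
Qed.

Lemma measurable_gamma_integrand (D : set R) s :
  measurable_fun D (fun x : R => x `^ s * expR (- x)).
Proof.
apply: measurable_funTS; apply: measurable_funM => //.
by apply: measurableT_comp => //; exact: oppr_measurable.
Qed.

(** The shift by 2 makes every interval nondegenerate, 1/(n+2) < 1 < n+2, as integration by parts
    requires. *)
Lemma bigcup_itvcc_gt0 :
  \bigcup_n `[n.+2%:R^-1, n.+2%:R]%classic = `]0, +oo[%classic :> set R.
Proof.
apply/seteqP; split => x /=.
  move=> [n _] /=; rewrite !in_itv/= andbT => /andP[nx _].
  by rewrite (lt_le_trans _ nx)// invr_gt0.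
rewrite in_itv/= andbT => x0.
exists (maxn (Num.truncn x) (Num.truncn x^-1)) => //=.
rewrite in_itv/=; apply/andP; split.
  rewrite invf_ple ?posrE//; apply/ltW/(lt_le_trans (truncnS_gt _)).
  by rewrite ler_nat !ltnS leqW// leq_maxr.
apply/ltW/(lt_le_trans (truncnS_gt _)).
by rewrite ler_nat !ltnS leqW// leq_maxl.
Qed.

Lemma cvg_gamma_integral s :
  (\int[mu]_(x in `[n.+2%:R^-1%R, n.+2%:R%R]) (x `^ s * expR (- x))%:E
     @[n --> \oo]
   --> \int[mu]_(x in `]0%R, +oo[) (x `^ s * expR (- x))%:E)%E.
Proof.
rewrite -bigcup_itvcc_gt0; apply: ge0_nondecreasing_set_cvg_integral.
- move=> m n mn; apply/subsetPset/subset_itv; rewrite bnd_simp.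
    by rewrite lef_pV2 ?posrE// ler_nat.
  by rewrite ler_nat.
- by move=> n; exact: measurable_itv.
- by move=> n; apply/measurable_EFinP; exact: measurable_gamma_integrand.
- by move=> n x _; rewrite lee_fin mulr_ge0// ?powR_ge0 ?expR_ge0.
Qed.

(** Integrate by parts on [1/(n+2), n+2] and let n tend to infinity. The boundary term at 0 vanishes
    because s > 0, the one at infinity by exponential decay. Working in the extended reals avoids
    proving the integrals finite. *)
Lemma integral_gammaD1 s : 0 < s ->
  (\int[mu]_(x in `]0%R, +oo[) (x `^ s * expR (- x))%:E =
   s%:E * \int[mu]_(x in `]0%R, +oo[) (x `^ (s - 1) * expR (- x))%:E)%E.
Proof.
move=> s0; pose g (x : R) := x `^ s * expR (- x).
have n2V_gt0 n : 0 < n.+2%:R^-1 :> R by rewrite invr_gt0.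
have n2V_lt n : n.+2%:R^-1 < n.+2%:R :> R.
  by rewrite (@lt_trans _ _ 1) ?invf_lt1 ?ltr1n.
have n2oo : n.+2%:R @[n --> \oo] --> (+oo : set_system R).
  have := @cvgr_idn R; rewrite -(cvg_shiftn 2).
  by under eq_fun do rewrite addn2.
have g0 : g n.+2%:R^-1 @[n --> \oo] --> 0.
  apply: (@squeeze_cvgr _ _ _ _ (cst 0) (fun n => n.+2%:R^-1 `^ s)).
  - near=> n; rewrite mulr_ge0 ?powR_ge0 ?expR_ge0//=.
    by rewrite ler_piMr ?powR_ge0// expR_le1 oppr_le0.
  - exact: cvg_cst.
  - have /cvg_at_rightP := powR_cvg0 s0; apply; split => //.
    by apply/gtr0_cvgV0 => //; exact: nearW.
have gy : g n.+2%:R @[n --> \oo] --> 0.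
  exact: (cvg_comp _ _ n2oo (powR_expRN_cvgy s)).
have gIs : ((g n.+2%:R^-1 - g n.+2%:R)%:E + s%:E * \int[mu]_(x in
    `[n.+2%:R^-1%R, n.+2%:R%R]) (x `^ (s - 1) * expR (- x))%:E @[n --> \oo] -->
    0 + s%:E * \int[mu]_(x in `]0%R, +oo[) (x `^ (s - 1) * expR (- x))%:E)%E.
  apply: cvgeD; first by [].
    by apply: cvg_EFin; [exact: nearW|rewrite -(subr0 0); exact: cvgB].
  by apply: cvgeZl => //; exact: cvg_gamma_integral.
rewrite -[RHS]add0e; apply: (cvg_unique _ (@cvg_gamma_integral s)) => //.
apply: cvg_trans gIs; apply: near_eq_cvg; apply: nearW => n /=.
by rewrite (integral_gamma_parts s (n2V_gt0 n) (n2V_lt n)).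
Unshelve. all: by end_near. Qed.

(* No integrability is needed: if the integral were infinite, [fine] would send
   both sides to 0. *)
Lemma GammaD1 s : 0 < s -> Gamma (s + 1) = s * Gamma s.
Proof.
move=> s0; rewrite /Gamma /Rintegral addrK integral_gammaD1//.
have fineMl (I : \bar R) : fine (s%:E * I)%E = s * fine I.
  case: I => [r||]; first by rewrite -EFinM.
    by rewrite gt0_muley ?lte_fin//= mulr0.
  by rewrite gt0_muleNy ?lte_fin//= mulr0.
exact: fineMl.
Qed.

Lemma GammaDn s n : 0 < s ->
  Gamma (n%:R + s) = Gamma s * \prod_(i < n) (s + i%:R).
Proof.
move=> s0; elim: n => [|n IH]; first by rewrite add0r big_ord0 mulr1.
rewrite -natr1 addrAC GammaD1 ?ltr_wpDl// IH big_ord_recr/=.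
by rewrite mulrCA [_ + s]addrC (mulrC (_ + _)).
Qed.

(** Reversing the order of the factors turns the falling factorial of n+s-1 into the rising
    factorial of s that appears in [GammaDn]. *)
Lemma gbinom_prod s n :
  gbinom (n%:R + s - 1) n = (\prod_(i < n) (s + i%:R)) / n`!%:R.
Proof.
rewrite /gbinom; congr (_ / _); rewrite (reindex_inj rev_ord_inj)/=.
apply: eq_bigr => i _; rewrite natrB// -[i.+1%:R]natr1; ring.
Qed.

Lemma Gamma_ge0 s : 0 <= Gamma s.
Proof.
by apply: Rintegral_ge0 => x _; rewrite mulr_ge0 ?powR_ge0 ?expR_ge0.
Qed.

End gamma_function.

(** * Measures and product integrals on tuples *)

(** Uniqueness of measures on a generating pi-system: boxes are stable under intersection. Since
    [m1] is finite, the constant sequence [setT] serves as the exhaustion. *)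
Lemma eq_measure_tuple_box (R : realType) (n : nat)
    (m1 m2 : {measure set (n.-tuple R) -> \bar R}) :
  (m1 setT < +oo)%E ->
  (forall A : 'I_n -> set R, (forall i, measurable (A i)) ->
    m1 [set x | forall i, A i (tnth x i)] =
    m2 [set x | forall i, A i (tnth x i)]) ->
  forall E : set (n.-tuple R), measurable E -> m1 E = m2 E.
Proof.
move=> m1oo m12 E mE.
pose G : set (set (n.-tuple R)) := [set B | exists2 A : 'I_n -> set R,
  (forall i, measurable (A i)) & B = [set x | forall i, A i (tnth x i)]].
have GT : G setT by exists (fun=> setT) => //; apply/seteqP; split.
have mG : G `<=` measurable.
  by move=> _ [A mA ->]; exact: measurable_tuple_box.
apply: (@g_sigma_algebra_measure_unique _ _ _ G mG (fun=> setT)) => //.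
- by rewrite bigcup_const.
- move=> _ _ [A mA ->] [B mB ->]; exists (fun i => A i `&` B i).
    by move=> i; exact: measurableI.
  apply/seteqP; split => [x [Ax Bx] i|x ABx]; first by split.
  by split => i; have [] := ABx i.
- by move=> _ [A mA ->]; exact: m12.
move: mE; rewrite /measurable/=; apply: smallest_sub.
  exact: smallest_sigma_algebra.
(* A generator is the preimage of a measurable set under one coordinate, hence a box whose other
   sides are full. *)
move=> B; rewrite -bigcup_seq/= => -[i _ [C mC <-]]; apply: sub_sigma_algebra.
exists (fun j => if j == i then C else setT) => [j|]; first by case: ifP.
rewrite setTI; apply/seteqP; split => [x Cx j|x /(_ i)]; last by rewrite eqxx.
by case: eqP => // ->.
Qed.

(** Induction on the dimension: Tonelli separates the first coordinate from the others. *)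
Lemma integral_lebesgue_tuple_prod (R : realType) (n : nat)
    (f : 'I_n -> R -> R) :
  (forall i, measurable_fun setT (f i)) -> (forall i x, 0 <= f i x) ->
  (\int[lebesgue_tuple R n]_x (\prod_(i < n) f i (tnth x i))%:E =
   \prod_(i < n) \int[lebesgue_measure]_x (f i x)%:E)%E.
Proof.
elim: n f => [|n IH] f mf f0.
  rewrite big_ord0 /= integral_dirac//= ?diracT ?mul1e ?big_ord0//.
  by under eq_fun do rewrite big_ord0; exact: measurable_cst.
have mprod k (h : 'I_k -> R -> R) : (forall i, measurable_fun setT (h i)) ->
    measurable_fun setT (fun x : k.-tuple R => (\prod_(i < k) h i (tnth x i))).
  move=> mh; apply: measurable_prod => i _.
  by apply: measurableT_comp => //; exact: measurable_tnth.
(* By definition the measure in dimension n+1 is the image under [tcons] of a product measure; this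
   exposes it. *)
rewrite [LHS](_ : _ =
  \int[pushforward (lebesgue_measure \x lebesgue_tuple R n)%E (@tcons R n)]_x
    (\prod_(i < n.+1) f i (tnth x i))%:E)%E//.
rewrite ge0_integral_pushforward//=; last 3 first.
- exact: measurable_tcons.
- by apply/measurable_EFinP; exact: mprod.
- by move=> x _; rewrite lee_fin prodr_ge0.
rewrite preimage_setT fubini_tonelli1//=; last 2 first.
- apply/measurable_EFinP.
  exact: (measurableT_comp (mprod _ _ mf) (measurable_tcons (n := n))).
- by move=> x; rewrite lee_fin prodr_ge0.
rewrite big_ord_recl -(IH (fun i => f (lift ord0 i)))//.
rewrite -ge0_integralZr//=; last 3 first.
- by apply/measurable_EFinP; exact: mf.
- by move=> x _; rewrite lee_fin.
- by apply: integral_ge0 => y _; rewrite lee_fin prodr_ge0.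
apply: eq_integral => x _; rewrite /fubini_F -ge0_integralZl//=; last 3 first.
- by apply/measurable_EFinP; apply: (mprod _ (fun i => f (lift ord0 i))).
- by move=> y _; rewrite lee_fin prodr_ge0.
- by rewrite lee_fin.
apply: eq_integral => y _; rewrite -EFinM big_ord_recl; congr (_ * _)%:E.
by apply: eq_bigr => i _; rewrite tnthS.
Qed.

(** The indicator of a box is the product of the indicators of its sides, so each one can be
    absorbed into its factor [f i]. *)
Lemma integral_lebesgue_tuple_box (R : realType) (n : nat)
    (f : 'I_n -> R -> R) (A : 'I_n -> set R) :
  (forall i, measurable (A i)) ->
  (forall i, measurable_fun setT (f i)) -> (forall i x, 0 <= f i x) ->
  (\int[lebesgue_tuple R n]_(x in [set x | forall i, A i (tnth x i)])
     (\prod_(i < n) f i (tnth x i))%:E =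
   \prod_(i < n) \int[lebesgue_measure]_(x in A i) (f i x)%:E)%E.
Proof.
move=> mA mf f0.
pose h i x := f i x * \1_(A i) x.
transitivity (\int[lebesgue_tuple R n]_x (\prod_(i < n) h i (tnth x i))%:E)%E.
  rewrite [LHS]integral_mkcond; apply: eq_integral => x _; rewrite patchE.
  rewrite big_split/=; case: ifPn => [/set_mem/= Ax|/negP Ax].
    by rewrite [X in _ * X]big1 ?mulr1// => i _; rewrite indicE mem_set.
  have [i nAx] : exists i, ~ A i (tnth x i).
    by apply/existsNP => Ax'; apply: Ax; rewrite inE.
  by rewrite [X in _ * X](bigD1 i)//= indicE memNset// mul0r mulr0.
rewrite integral_lebesgue_tuple_prod => [|i|i x]; last 2 first.
- by apply: measurable_funM => //; exact: measurable_indic.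
- by rewrite mulr_ge0// indicE.
apply: eq_bigr => i _; rewrite [RHS]integral_mkcond; apply: eq_integral => x _.
by rewrite patchE /h indicE; case: ifP => _; rewrite ?mulr1 ?mulr0.
Qed.

(** Used to split the product given by independence into the factor of [B], at [None], and those of
    the [Z i]. *)
Lemma big_option (R : Type) (idx : R) (op : Monoid.com_law idx) (I : finType)
    (F : option I -> R) :
  \big[op/idx]_(k : option I) F k =
  op (F None) (\big[op/idx]_(i : I) F (Some i)).
Proof.
rewrite (bigD1 None)//=; congr (op _ _).
rewrite (reindex_omap Some id)/=; last by case.
by apply: eq_bigl => i; rewrite eqxx.
Qed.

(** * The terms of the density series *)

Section gamma_subordinator_terms.
Context {R : realType} (q : nat) (lambda theta : R) (a : 'I_q -> R) (t : R).
Hypothesis theta_ge0 : 0 <= theta.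
Hypothesis s_gt0 : 0 < lambda * t.
(** Supplied later by [Gamma_gt0_pdf], from the total mass of a gamma law. *)
Hypothesis Gamma_gt0 : 0 < Gamma (lambda * t).
Hypothesis a_gt0 : forall i, 0 < a i.
Local Notation term := (gamma_subordinator_term lambda theta a t).

(** With s = [lambda * t], the rising factorial of s equals 1 at n = 0 and s at n = 1. From there it
    does not decrease, each further factor s+i being at least 1. *)
Lemma GammaDn_bounded_below :
  exists2 c : R, 0 < c & forall n, c <= Gamma (n%:R + lambda * t).
Proof.
exists (Gamma (lambda * t) * Num.min 1 (lambda * t)) => [|n].
  by rewrite mulr_gt0// lt_min ltr01.
rewrite GammaDn// ler_wpM2l ?(ltW Gamma_gt0)//.
elim: n => [|[|n] IH]; first by rewrite big_ord0 ge_min lexx.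
  by rewrite big_ord1 addr0 ge_min lexx orbT.
rewrite big_ord_recr/= (le_trans IH)// ler_peMr//.
  by apply: prodr_ge0 => i _; rewrite addr_ge0// ltW.
by rewrite -[n.+1%:R]natr1 addrA lerDr addr_ge0// ltW.
Qed.

Lemma gamma_subordinator_term_ge0 (x : q.-tuple R) n :
  (forall i, 0 < tnth x i) -> 0 <= term x n.
Proof.
move=> x0; rewrite /gamma_subordinator_term mulr_ge0//.
  by rewrite divr_ge0 ?exprn_ge0// mulr_ge0// exprn_ge0// Gamma_ge0.
apply: prodr_ge0 => i _; rewrite mulr_ge0 ?expR_ge0//.
by rewrite divr_ge0 ?powR_ge0// ltW.
Qed.

(** Comparison with the exponential series: the n-th powers collect into y^n/n!, and the remaining
    dependence on n, the inverse power of Gamma, is bounded uniformly by [GammaDn_bounded_below]. *)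
Lemma is_cvg_gamma_subordinator_term (x : q.-tuple R) :
  (forall i, 0 < tnth x i) -> cvgn (series (term x)).
Proof.
move=> x0; have [c c0 cG] := GammaDn_bounded_below.
pose y := theta * \prod_(i < q) (a i * tnth x i).
pose C := c ^- q.-1 * \prod_(i < q) ((a i * tnth x i) `^ (lambda * t)
  / tnth x i * expR (- (a i * tnth x i))).
have ax0 i : 0 < a i * tnth x i by rewrite mulr_gt0.
have y0 : 0 <= y by rewrite mulr_ge0// prodr_ge0// => i _; rewrite ltW.
have C0 : 0 <= C.
  rewrite mulr_ge0 ?invr_ge0 ?exprn_ge0 ?(ltW c0)// prodr_ge0// => i _.
  by rewrite mulr_ge0 ?expR_ge0// divr_ge0 ?powR_ge0// ltW.
apply: (@series_le_cvg _ _ (fun n => C * exp_coeff y n)) => [n|n|n|].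
- exact: gamma_subordinator_term_ge0.
- by rewrite mulr_ge0// divr_ge0// exprn_ge0.
- have -> : term x n = (Gamma (n%:R + lambda * t) ^- q.-1 *
      \prod_(i < q) ((a i * tnth x i) `^ (lambda * t)
      / tnth x i * expR (- (a i * tnth x i)))) * exp_coeff y n.
    rewrite /gamma_subordinator_term /exp_coeff/= /y exprMn -prodrXl.
    rewrite [X in _ * X](_ : _ = \prod_(i < q) (a i * tnth x i) ^+ n *
      \prod_(i < q) ((a i * tnth x i) `^ (lambda * t)
      / tnth x i * expR (- (a i * tnth x i)))); last first.
      rewrite -big_split; apply: eq_bigr => i _ /=.
      rewrite powRD ?(gt_eqF (ax0 i)) ?implybT// powR_mulrn ?(ltW (ax0 i))//.
      by rewrite !mulrA.
    rewrite invfM; ring.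
  rewrite ler_wpM2r ?divr_ge0 ?exprn_ge0// ler_wpM2r//.
    rewrite prodr_ge0// => i _.
    by rewrite mulr_ge0 ?expR_ge0// divr_ge0 ?powR_ge0// ltW.
  rewrite lef_pV2 ?posrE ?exprn_gt0//; last exact: lt_le_trans (cG n).
  by rewrite lerXn2r ?nnegrE ?(ltW c0)// (le_trans (ltW c0)).
- by apply: is_cvg_seriesZ; exact: is_cvg_series_exp_coeff.
Qed.

(** The left side is the probability that the negative binomial variable equals n times the
    conditional density of the vector given that value. *)
Lemma gamma_pdf_prodE (x : q.-tuple R) n :
  (0 < q)%N -> (forall i, 0 < tnth x i) ->
  (1 - theta) `^ (lambda * t) * gbinom (n%:R + lambda * t - 1) n * theta ^+ n *
  \prod_(i < q) gamma_pdf (n%:R + lambda * t) (a i) (tnth x i) =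
  (1 - theta) `^ (lambda * t) / Gamma (lambda * t) * term x n.
Proof.
move=> q0 x0.
have Gn0 : Gamma (n%:R + lambda * t) != 0.
  have [c c0 cG] := GammaDn_bounded_below; by rewrite gt_eqF// (lt_le_trans c0).
have -> : \prod_(i < q) gamma_pdf (n%:R + lambda * t) (a i) (tnth x i) =
  Gamma (n%:R + lambda * t) ^- q *
  \prod_(i < q) ((a i * tnth x i) `^ (n%:R + lambda * t) / tnth x i
                   * expR (- (a i * tnth x i))).
  rewrite -exprVn -[in X in _ ^+ X](card_ord q) -prodr_const -big_split.
  apply: eq_bigr => i _ /=; rewrite /gamma_pdf x0.
  rewrite powRM ?(ltW (a_gt0 i)) ?(ltW (x0 i))//.
  rewrite powRB ?(gt_eqF (x0 i)) ?implybT// powRr1 ?(ltW (x0 i))//.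
  ring.
have -> : gbinom (n%:R + lambda * t - 1) n =
    Gamma (n%:R + lambda * t) / Gamma (lambda * t) / n`!%:R.
  by rewrite gbinom_prod GammaDn// [Gamma _ * _]mulrC mulfK// gt_eqF.
(* Positivity of [q] allows one factor Gamma(n+s) to be split off and cancelled against the binomial
   coefficient. *)
rewrite /gamma_subordinator_term -[in X in _ ^- X](prednK q0) exprS.
have G0 : Gamma (lambda * t) != 0 by rewrite gt_eqF.
have n0 : n`!%:R != 0 :> R by rewrite pnatr_eq0 -lt0n fact_gt0.
have Gnq0 : Gamma (n%:R + lambda * t) ^+ q.-1 != 0 by rewrite expf_neq0.
field; exact/and4P.
Qed.

End gamma_subordinator_terms.

(** * Reduction of the density property to boxes *)

Section density_measure.
Context d (T : measurableType d) (R : realType)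
  (mu : {measure set T -> \bar R}) (g : T -> R).
Hypotheses (mg : measurable_fun setT g) (g_ge0 : forall x, 0 <= g x).

Definition density_measure (A : set T) : \bar R :=
  (\int[mu]_(x in A) (g x)%:E)%E.

Let density0 : density_measure set0 = 0%E.
Proof. exact: integral_set0. Qed.

Let density_ge0 A : (0 <= density_measure A)%E.
Proof. by apply: integral_ge0 => x _; rewrite lee_fin. Qed.

Let density_sigma_additive : semi_sigma_additive density_measure.
Proof.
move=> F mF tF mUF; rewrite /density_measure; apply: cvg_toP.
  apply: ereal_nondecreasing_is_cvgn => m n mn.
  apply: lee_sum_nneg_natr => // k _ _; exact: density_ge0.
rewrite ge0_integral_bigcup//=.
- by apply/measurable_EFinP; exact: measurable_funTS.
- by move=> x _; rewrite lee_fin.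
Qed.

HB.instance Definition _ := isMeasure.Build _ _ _ density_measure
  density0 density_ge0 density_sigma_additive.

Definition density : {measure set T -> \bar R} := density_measure.

End density_measure.

(** Both sides are measures of the set: the law of [X], of mass 1, and the measure with density [g].
    Uniqueness on boxes applies. *)
Lemma has_density_box d (T : measurableType d) (R : realType)
    (P : probability T R) (q : nat) (X : T -> q.-tuple R)
    (g : q.-tuple R -> R) :
  measurable_fun setT X -> measurable_fun setT g -> (forall x, 0 <= g x) ->
  (forall A : 'I_q -> set R, (forall i, measurable (A i)) ->
    P (X @^-1` [set x | forall i, A i (tnth x i)]) =
    (\int[lebesgue_tuple R q]_(x in [set x | forall i, A i (tnth x i)])
       (g x)%:E)%E) ->
  has_density P X g.
Proof.
move=> mX mg g0 PXg; split => // A mA.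
pose PX :=
  measure_function_pushforward__canonical__measure_function_Measure P mX.
pose gL := density (lebesgue_tuple R q) mg g0.
apply: (@eq_measure_tuple_box _ _ PX gL) => //.
by rewrite /= /pushforward preimage_setT probability_setT ltry.
Qed.

(* Since fine +oo = 0 and 0^-1 = 0, the density would vanish if Gamma shape were
   0: total mass 1 thus gives positivity and finiteness of the Gamma integral. *)
Lemma Gamma_gt0_pdf (R : realType) (shape rate : R) :
  (\int[lebesgue_measure]_x (gamma_pdf shape rate x)%:E = 1)%E ->
  0 < Gamma shape.
Proof.
move=> pdf1; rewrite lt0r Gamma_ge0 andbT; apply/eqP => G0.
have : (\int[lebesgue_measure]_x (gamma_pdf shape rate x)%:E = 0)%E.
  apply: integral0_eq => x _; rewrite /gamma_pdf G0 invr0 mulr0 !mul0r.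
  by case: ifP.
by rewrite pdf1 => /eqP; rewrite onee_eq0.
Qed.

Lemma measurable_gamma_pdf (R : realType) (shape rate : R) :
  measurable_fun setT (gamma_pdf shape rate).
Proof.
apply: measurable_fun_ifT => //.
  exact: measurable_fun_ltr.
apply: measurable_funM; first apply: measurable_funM => //.
by apply: measurableT_comp => //; exact: measurableT_comp.
Qed.

Lemma gamma_pdf_ge0 (R : realType) (shape rate x : R) :
  0 <= gamma_pdf shape rate x.
Proof.
rewrite /gamma_pdf; case: ifP => // _.
by rewrite !mulr_ge0 ?expR_ge0 ?powR_ge0 ?invr_ge0 ?Gamma_ge0.
Qed.

(** The preimage splits over the countably many values of [N]. This handles a process read at a
    discrete random time without joint measurability in time and outcome. *)
Lemma measurable_fun_nat_index d d' (T : measurableType d)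
    (S : measurableType d')
    (N : T -> nat) (X : nat -> T -> S) :
  (forall n, measurable (N @^-1` [set n])) ->
  (forall n, measurable_fun setT (X n)) ->
  measurable_fun setT (fun w => X (N w) w).
Proof.
move=> mN mX _ A mA; rewrite setTI.
rewrite (_ : _ @^-1` A = \bigcup_n (N @^-1` [set n] `&` X n @^-1` A)).
  apply: bigcup_measurable => n _; apply: measurableI => //.
  by rewrite -[X in measurable X]setTI; exact: mX.
apply/seteqP; split => [w Aw|w [n _ [/= <-]]//].
by exists (N w).
Qed.

(** * The density of the multivariate gamma subordinator *)

Theorem proposition3p1 (R : realType) (d : measure_display)
    (T : measurableType d) (P : probability T R)
    (q : nat) (lambda theta : R) (a : 'I_q -> R)
    (Z : 'I_q -> R -> T -> R) (B : R -> T -> nat)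
    (hq : (0 < q)%N) (hlambda : 0 < lambda)
    (htheta0 : 0 < theta) (htheta1 : theta < 1)
    (ha : forall i, 0 < a i)
    (hZ : forall i, gamma_levy_process P lambda (a i) (Z i))
    (hB : negative_binomial_levy_process P lambda theta
            (fun t => B (lambda * t)))
    (hind : mutually_independent P (fun k : option 'I_q =>
              if k is Some i then sigma_process (Z i)
              else sigma_process (fun t => B (lambda * t)))) :
  forall t : R, 0 < t ->
    (forall x : q.-tuple R, (forall i, 0 < tnth x i) ->
       cvgn (series (gamma_subordinator_term lambda theta a t x))) /\
    has_density P (gamma_subordinator lambda Z B t)
      (gamma_subordinator_pdf lambda theta a t).
Proof.
move=> t t0; have s0 : 0 < lambda * t by rewrite mulr_gt0.
(* As [q] is positive there is a component with index 0; its gamma law at time t has total mass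
   1. *)
have G0 : 0 < Gamma (lambda * t).
  apply: (@Gamma_gt0_pdf _ _ (a (Ordinal hq))).
  by rewrite -(hZ (Ordinal hq)).2// preimage_setT probability_setT.
have th0 := ltW htheta0.
have cvg_term x := is_cvg_gamma_subordinator_term (x := x) th0 s0 G0 ha.
split; first exact: cvg_term.
(* The value of the random time when [B (lambda * t)] is n; the gamma shape at that time is n +
   [lambda * t]. *)
pose tau n : R := t + lambda^-1 * n%:R.
have tau0 n : 0 < tau n by rewrite ltr_wpDr// mulr_ge0// invr_ge0 ltW.
have lambda_tau n : lambda * tau n = n%:R + lambda * t.
  by rewrite mulrDr mulVKf ?gt_eqF// addrC.
pose p n : R := (1 - theta) `^ (lambda * t) * gbinom (n%:R + lambda * t - 1) n
  * theta ^+ n.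
(* Nonnegative because it is a probability. *)
have p0 n : 0 <= p n.
  have := hB.2 t n (ltW t0); rewrite -/(p n) => pE.
  by rewrite -lee_fin -pE.
pose w n (x : q.-tuple R) : R :=
  p n * \prod_(i < q) gamma_pdf (n%:R + lambda * t) (a i) (tnth x i).
have w0 n x : 0 <= w n x.
  by rewrite mulr_ge0// prodr_ge0// => i _; exact: gamma_pdf_ge0.
have mw n : measurable_fun setT (w n).
  apply: measurable_funM => //; apply: measurable_prod => i _.
  apply: measurableT_comp; first exact: measurable_gamma_pdf.
  exact: measurable_tnth.
pose g := gamma_subordinator_pdf lambda theta a t.
(* The convergence holds at every point: if some coordinate is not positive, one gamma factor makes
   each [w n] vanish, in agreement with the default value 0 of [g]. *)
have wg x : series (w ^~ x) n @[n --> \oo] --> g x.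
  rewrite /g /gamma_subordinator_pdf; case: ifPn => [/forallP x0|].
    rewrite (_ : series _ =
      ((1 - theta) `^ (lambda * t) / Gamma (lambda * t)) *:
      series (gamma_subordinator_term lambda theta a t x)).
      by apply: cvgZl_tmp; exact: cvg_term.
    rewrite -seriesZ; congr (series _); apply/funext => n.
    exact: gamma_pdf_prodE.
  rewrite negb_forall => /existsP[i xi].
  rewrite (_ : series _ = fun=> 0); first exact: cvg_cst.
  apply/funext => n; rewrite /series/= big1// => k _.
  by rewrite /w (bigD1 i)//= /gamma_pdf (negbTE xi) mul0r mulr0.
have EFin_g x : (g x)%:E = (\sum_(n <oo) (w n x)%:E)%E.
  apply/esym/cvg_lim => //.
  under eq_fun do rewrite sumEFin.
  exact: (cvg_comp _ _ (wg x)).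
(* Measurability is given for the real-valued cast of [B]; injectivity of the cast transfers it to
   the fibres. *)
have mB n : measurable (B (lambda * t) @^-1` [set n]).
  have := @levy_measurable _ _ _ _ _ hB.1 t (ltW t0) measurableT [set n%:R].
  rewrite setTI (_ : _ @^-1` _ = B (lambda * t) @^-1` [set n]); first exact.
  by apply/seteqP; split => u /= => [/eqP|->//]; rewrite eqr_nat => /eqP.
have mZ i n : measurable_fun setT (Z i (tau n)).
  by apply: (levy_measurable (hZ i).1); exact: ltW.
(* On the event that [B (lambda * t)] is n, the random time is the constant [tau n], so the box
   condition involves only the variables [Z i (tau n)]. *)
pose E n (A : 'I_q -> set R) := B (lambda * t) @^-1` [set n] `&`
  [set u | forall i, A i (Z i (tau n) u)].
have PE n A : (forall i, measurable (A i)) -> P (E n A) =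
    (\int[lebesgue_tuple R q]_(x in [set x | forall i, A i (tnth x i)])
       (w n x)%:E)%E.
  move=> mA.
  (* One event from each independent sigma-algebra; their intersection is [E n A]. *)
  pose F (k : option 'I_q) := if k is Some i then Z i (tau n) @^-1` A i
    else B (lambda * t) @^-1` [set n].
  have : P (\bigcap_(k in [set` [set: option 'I_q]%SET]) F k) =
      (\prod_(k in [set: option 'I_q]%SET) P (F k))%E.
    apply: hind => -[i|] _; apply: sub_sigma_algebra.
      exists (tau n); first exact: ltW.
      by exists (A i) => //; rewrite setTI.
    exists t; first exact: ltW.
    by exists [set n] => //; rewrite setTI.
  rewrite (_ : \bigcap_(_ in _) _ = E n A); last first.
    apply/seteqP; split => [u Fu|u [Bu Au] [i|] _//=].
    by split => [|i]; [apply: (Fu None)|apply: (Fu (Some i))]; rewrite /= inE.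
  move=> ->.
  under eq_integral do rewrite EFinM.
  rewrite ge0_integralZl//; last 4 first.
  - exact: measurable_tuple_box.
  - apply/measurable_EFinP; apply: measurable_prod => i _.
    apply: measurable_funTS; apply: measurableT_comp.
      exact: measurable_gamma_pdf.
    exact: measurable_tnth.
  - by move=> x _; rewrite lee_fin prodr_ge0// => i _; exact: gamma_pdf_ge0.
  - by rewrite lee_fin.
  rewrite (@integral_lebesgue_tuple_box _ _
    (fun i => gamma_pdf (n%:R + lambda * t) (a i)))//; last 2 first.
  - by move=> i; exact: measurable_gamma_pdf.
  - by move=> i x; exact: gamma_pdf_ge0.
  rewrite (eq_bigl xpredT) ?big_option; last by move=> k; rewrite inE.
  congr (_ * _)%E; first exact: (hB.2 t n (ltW t0)).
  apply: eq_bigr => i _; rewrite (hZ i).2//.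
  by rewrite lambda_tau.
apply: has_density_box.
- apply: (measurable_fun_nat_index (N := B (lambda * t))
    (X := fun n u => [tuple Z i (tau n) u | i < q])) => // n.
  apply/measurable_fun_tnthP => i.
  rewrite (_ : _ \o _ = Z i (tau n)); first exact: mZ.
  by apply/funext => u /=; rewrite tnth_mktuple.
(* Measurability of [g] as a pointwise limit of the partial sums. *)
- apply: (@measurable_fun_cvg _ _ _ _ (fun n x => series (w ^~ x) n) g).
    move=> n; apply: measurable_sum => k; exact: mw.
  by move=> x _; exact: wg.
- move=> x; rewrite -/g -lee_fin EFin_g; apply: nneseries_ge0 => n _ _.
  by rewrite lee_fin.
move=> A mA.
have mE n : measurable (E n A).
  apply: measurableI => //.
  rewrite (_ : mkset _ = \bigcap_(i in [set: 'I_q]) (Z i (tau n) @^-1` A i)).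
    apply: fin_bigcap_measurable => // i _.
    by rewrite -[X in measurable X]setTI; exact: mZ.
  by apply/seteqP; split => u /= Au i; [move=> _|]; apply: Au.
have mbox := measurable_tuple_box mA.
rewrite -/g; under eq_integral do rewrite EFin_g.
(* Sum and integral are exchanged by nonnegativity of the [w n]. *)
rewrite integral_nneseries//; last 2 first.
- by move=> n; apply/measurable_EFinP; exact: measurable_funTS.
- by move=> n x _; rewrite lee_fin.
under eq_eseriesr do rewrite -PE//.
rewrite (_ : _ @^-1` _ = \bigcup_n E n A).
  apply: measure_semi_bigcup.
  - by move=> n; exact: mE.
  (* A common point u forces both indices to equal [B (lambda * t) u], so the pieces are
     disjoint. *)
  - move=> i j _ _ [u [[/= <- _] [/= <- _]]].
    by [].
  - by apply: bigcup_measurable => n _; exact: mE.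
apply/seteqP; split => [u Au|u [n _ [/= <-] Au] i].
  exists (B (lambda * t) u) => //; split => // i.
  by have := Au i; rewrite /= tnth_mktuple.
by rewrite /= tnth_mktuple.
Qed.
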